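(* Let $\underline{A},\overline{A}\in\mathbb{R}^{n\times n}$ with $\underline{A}\le\overline{A}$ (entrywise), let $\mathbf{A}=\{A\in\mathbb{R}^{n\times n} : \underline{A}\le A\le\overline{A}\}$, and let $A^c=\frac12(\underline{A}+\overline{A})$. Assume that $A^c$ is an $M$-matrix. Then $\mathbf{A}$ is strongly an $R$-matrix if and only if $\mathbf{A}$ is strongly an $H$-matrix.
   Context: All inequalities between vectors or matrices are entrywise; $e=(1,\dots,1)^T$ is the all-ones vector of the appropriate dimension. A matrix property holds strongly for an interval matrix $\mathbf{A}$ if it holds for every $A\in\mathbf{A}$. For index sets $I,J$, $A_{I,J}$ is the submatrix of $A$ with rows indexed by $I$ and columns indexed by $J$. A matrix $A\in\mathbb{R}^{n\times n}$ is an $R$-matrix (regular) if for each $\emptyset\ne I\subseteq\{1,\dots,n\}$, with $J:=\{1,\dots,n\}\setminus I$, the system $A_{I,I}x+et=0$, $A_{J,I}x+et\ge0$, $x>0$, $t\ge0$ in variables $x\in\mathbb{R}^{|I|}$, $t\in\mathbb{R}$ is infeasible. A matrix $A$ is an $M$-matrix if $A=sI_n-N$ for some $N\ge0$ and $s\in\mathbb{R}$ with $s>\rho(N)$, where $\rho$ is the spectral radius. A matrix $A$ is an $H$-matrix if its comparison matrix $\langle A\rangle$, given by $\langle A\rangle_{ii}=|a_{ii}|$ and $\langle A\rangle_{ij}=-|a_{ij}|$ for $i\ne j$, is an $M$-matrix. *)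

(* Defs.v *)
From mathcomp Require Import all_boot all_order all_algebra.
From mathcomp Require Import all_classical all_reals.
From mathcomp Require Import complex.

Set Implicit Arguments.
Unset Strict Implicit.
Unset Printing Implicit Defensive.

Import Order.TTheory GRing.Theory Num.Theory.

Local Open Scope classical_set_scope.
Local Open Scope ring_scope.

Definition mxle (R : realType) (m n : nat) (A B : 'M[R]_(m, n)) : Prop :=
  forall i j, A i j <= B i j.

Definition mxlt (R : realType) (m n : nat) (A B : 'M[R]_(m, n)) : Prop :=
  forall i j, A i j < B i j.

Definition interval_matrix (R : realType) (n : nat) (Al Au : 'M[R]_n) :
    set 'M[R]_n :=
  [set A | mxle Al A /\ mxle A Au].

Definition midpoint_matrix (R : realType) (n : nat) (Al Au : 'M[R]_n) :
    'M[R]_n :=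
  2^-1 *: (Al + Au).

Definition strongly (R : realType) (n : nat) (P : 'M[R]_n -> Prop)
    (S : set 'M[R]_n) : Prop :=
  forall A, S A -> P A.

(* Rows and columns of the submatrix are listed in increasing order of index. *)
Definition submatrix (R : realType) (n : nat) (A : 'M[R]_n)
    (I J : {set 'I_n}) : 'M[R]_(#|I|, #|J|) :=
  mxsub (fun i => enum_val i) (fun j => enum_val j) A.

Definition ones (R : realType) (m : nat) : 'cV[R]_m := const_mx 1.

Definition R_matrix (R : realType) (n : nat) (A : 'M[R]_n) : Prop :=
  forall I : {set 'I_n}, I != finset.set0 ->
  ~ exists (x : 'cV[R]_#|I|) (t : R),
      [/\ submatrix A I I *m x + t *: ones R #|I| = 0,
          mxle 0 (submatrix A (~: I)%SET I *m x + t *: ones R #|(~: I)%SET|),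
          mxlt 0 x
        & 0 <= t].

(* The maximal modulus of the complex eigenvalues; for n > 0 the set below is
   finite and nonempty, and for n = 0 it is empty and [sup] gives 0. *)
Definition spectral_radius (R : realType) (n : nat) (A : 'M[R]_n) : R :=
  sup [set r : R | exists2 z : complex R,
         eigenvalue (map_mx (real_complex R) A) z & r = Normc.normc z].

Definition M_matrix (R : realType) (n : nat) (A : 'M[R]_n) : Prop :=
  exists (N : 'M[R]_n) (s : R),
    [/\ mxle 0 N, spectral_radius N < s & A = s%:M - N].

Definition comparison_matrix (R : realType) (n : nat) (A : 'M[R]_n) :
    'M[R]_n :=
  \matrix_(i, j) (if i == j then `|A i j| else - `|A i j|).

Definition H_matrix (R : realType) (n : nat) (A : 'M[R]_n) : Prop :=
  M_matrix (comparison_matrix A).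

(* Main.v *)
(** The M-matrices are exactly the matrices with nonpositive off-diagonal
entries (Z-matrices) that map some positive vector to a positive vector
(semipositivity).  Along a segment of Z-matrices, semipositivity can only be
lost through a matrix with a nonnegative nonzero kernel vector: normalise the
solutions of [M y = e] to the simplex and use compactness.

If the interval matrix is strongly R but its lower bound [Al] is not
semipositive, the segment from the midpoint to [Al] contains such a singular
matrix, whose kernel vector solves the R-matrix system with [t = 0].  So [Al]
is an M-matrix, and it lies below the comparison matrix of every member.

Conversely, if the interval matrix is strongly H, then by convexity all
diagonal entries keep the positive sign of those of the midpoint.  A solution
of the R-matrix system for [A], extended by zero to [z >= 0], would satisfy
[comparison_matrix A *m z <= 0], hence [z <= 0] by monotonicity of
M-matrices. *)

Require Import Defs.
From mathcomp Require Import all_boot all_order all_algebra.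
From mathcomp Require Import all_classical all_reals.
From mathcomp Require Import all_analysis.
From mathcomp Require Import complex ring lra.

Set Implicit Arguments.
Unset Strict Implicit.
Unset Printing Implicit Defensive.

Import Order.TTheory GRing.Theory Num.Theory.
Import numFieldNormedType.Exports.

Local Open Scope classical_set_scope.
Local Open Scope ring_scope.

(** * Z-matrices and semipositivity *)

Definition Z_matrix (R : realType) (n : nat) (M : 'M[R]_n) : Prop :=
  forall i j, i != j -> M i j <= 0.

Definition semipositive (R : realType) (n : nat) (M : 'M[R]_n) : Prop :=
  exists2 x : 'cV[R]_n, mxlt 0 x & mxlt 0 (M *m x).

Definition segment_mx (R : realType) (n : nat) (P Q : 'M[R]_n) (t : R) :
    'M[R]_n :=
  (1 - t) *: P + t *: Q.

Section Semipositive.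
Variables (R : realType) (n : nat).
Implicit Types (M N P Q : 'M[R]_n) (x y : 'cV[R]_n).

Lemma pos_lower_bound (f : 'I_n -> R) :
  (forall i, 0 < f i) -> exists2 e : R, 0 < e & forall i, e <= f i.
Proof.
(* The seed [1] keeps the minimum positive when [n = 0]. *)
move=> f0; exists (\big[Num.min/1]_i f i); last by move=> i; exact: bigmin_le.
by apply: lt_bigmin => // i _; exact: f0.
Qed.

Lemma Z_matrix_monotone M y :
  Z_matrix M -> semipositive M -> mxle 0 (M *m y) -> mxle 0 y.
Proof.
move=> ZM [x x0 Mx0] My0 k j; rewrite {j}(ord1 j) leNgt mxE; apply/negP => yk.
have x0' i : 0 < x i 0 by have := x0 i 0; rewrite mxE.
(* At an index [i] minimising [y i / x i], entry [i] of [M *m (y - r *: x)]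
   would be both positive and nonpositive. *)
have [i _ imin] := @arg_minP _ R _ k xpredT (fun i => y i 0 / x i 0) isT.
set r := y i 0 / x i 0 in imin.
have r0 : r < 0.
  by rewrite (le_lt_trans (imin k isT)) // pmulr_llt0 ?invr_gt0.
have Mz : 0 < (M *m (y - r *: x)) i 0.
  have := My0 i 0; have := Mx0 i 0.
  rewrite mulmxBr -scalemxAr !mxE => p q.
  by rewrite subr_gt0 (lt_le_trans _ q) // nmulr_rlt0.
suff : (M *m (y - r *: x)) i 0 <= 0 by rewrite leNgt Mz.
rewrite mxE; apply: sumr_le0 => j _.
have [->|ij] := eqVneq j i.
  by rewrite !mxE /r divfK ?gt_eqF // subrr mulr0.
rewrite mulr_le0_ge0 ?ZM 1?eq_sym // !mxE subr_ge0 -ler_pdivlMr //.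
exact: imin.
Qed.

(** By monotonicity a kernel vector and its negative are both nonnegative, so [M] is invertible;
    monotonicity again makes the solution nonnegative. *)
Lemma Z_matrix_solve_ones M : Z_matrix M -> semipositive M ->
  exists2 y, mxle 0 y & M *m y = ones R n.
Proof.
move=> ZM SM.
have Mu : M \in unitmx.
  rewrite -unitmx_tr -row_free_unit -kermx_eq0; apply/eqP/row_matrixP => i.
  rewrite row0; set v := row i _.
  have /sub_kermxP vM : (v <= kermx M^T)%MS by exact: row_sub.
  have Mv : M *m v^T = 0 by rewrite -[M]trmxK -trmx_mul vM trmx0.
  have v0 : mxle 0 v^T by apply: (Z_matrix_monotone ZM SM) => a b; rewrite Mv.
  have v1 : mxle 0 (- v^T).
    by apply: (Z_matrix_monotone ZM SM) => a b; rewrite mulmxN Mv oppr0.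
  apply/rowP => j; have := v0 j 0; have := v1 j 0.
  by rewrite !mxE oppr_ge0 => p q; apply/eqP; rewrite eq_le p q.
exists (invmx M *m ones R n); last by rewrite mulKVmx.
apply: (Z_matrix_monotone ZM SM) => i j.
by rewrite mulKVmx // !mxE ler01.
Qed.

(** In row [i] of [M *m x] with [x] positive, only the diagonal term can be positive. *)
Lemma semipositive_diag M i :
  Z_matrix M -> semipositive M -> 0 < M i i.
Proof.
move=> ZM [x x0 /(_ i 0)]; rewrite !mxE (bigD1 i) //= => Mx.
have xi k : 0 < x k 0 by have := x0 k 0; rewrite mxE.
rewrite -(pmulr_lgt0 _ (xi i)) (lt_le_trans Mx) // gerDl sumr_le0 // => j ji.
by rewrite mulr_le0_ge0 ?ZM 1?eq_sym // ltW.
Qed.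

Lemma semipositive_le M M' : mxle M M' -> semipositive M -> semipositive M'.
Proof.
move=> MM' [x x0 Mx]; exists x => // i j; apply: (lt_le_trans (Mx i j)).
rewrite !mxE; apply: ler_sum => k _; rewrite ler_wpM2r //.
by have := x0 k j; rewrite mxE => /ltW.
Qed.

Lemma segment_mx_Z P Q t : 0 <= t <= 1 ->
  Z_matrix P -> Z_matrix Q -> Z_matrix (segment_mx P Q t).
Proof.
move=> /andP[t0 t1] ZP ZQ i j ij; rewrite !mxE.
by have := ZP i j ij; have := ZQ i j ij; nra.
Qed.

Lemma segment_mx_open P Q t : t < 1 -> semipositive (segment_mx P Q t) ->
  exists2 s : R, t < s <= 1 & semipositive (segment_mx P Q s).
Proof.
move=> t1 [x x0 Mx].
pose d i := (segment_mx P Q t *m x) i 0.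
pose b i := ((Q - P) *m x) i 0.
have d0 i : 0 < d i by have := Mx i 0; rewrite mxE.
(* A move by [u] changes entry [i] by [u * b i], so [u * (1 + |b i|) < d i] keeps it positive; the
   [1 +] keeps the denominator nonzero. *)
have [|e e0 eP] := @pos_lower_bound (fun i => d i / (1 + `|b i|)).
  by move=> i; rewrite divr_gt0 // ltr_pwDl.
pose u := Num.min (e / 2) (1 - t).
have u0 : 0 < u by rewrite lt_min subr_gt0 t1 divr_gt0.
have ue : u < e by rewrite gt_min; apply/orP; left; lra.
exists (t + u).
  by rewrite ltrDl u0 -lerBrDl ge_min lexx orbT.
exists x => // i j; rewrite {j}(ord1 j).
have -> : segment_mx P Q (t + u) = segment_mx P Q t + u *: (Q - P).
  by apply/matrixP => a c; rewrite !mxE; ring.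
rewrite mulmxDl -scalemxAl 2!mxE [X in _ < _ + X]mxE -/(d i) -/(b i).
have b0 : 0 < 1 + `|b i| by rewrite ltr_pwDl.
have ed : e * (1 + `|b i|) <= d i by rewrite -ler_pdivlMr.
have ub : u * (1 + `|b i|) < d i by rewrite (lt_le_trans _ ed) // ltr_pM2r.
have : - `|b i| <= b i by rewrite lerNl -normrN ler_norm.
move: ub u0; move: `|b i| (b i) (d i) => B b' d' ; nra.
Qed.

End Semipositive.

(** * Loss of semipositivity along a segment of Z-matrices *)

Section Segment.
Variables (R : realType) (n : nat).
Implicit Types (M N P Q : 'M[R]_n) (x y : 'cV[R]_n).

(** If [x i = 0], the diagonal term of row [i] vanishes and the others are nonpositive, against the
    positivity of [M *m x]; so [x] is already positive. *)
Lemma nonneg_semipositive M x :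
  Z_matrix M -> mxle 0 x -> mxlt 0 (M *m x) -> semipositive M.
Proof.
move=> ZM x0 Mx; exists x => // i j; rewrite {j}(ord1 j) lt_neqAle x0 andbT.
apply/eqP => xi; have := Mx i 0; apply/negP; rewrite -leNgt !mxE.
apply: sumr_le0 => j _; have [->|ij] := eqVneq j i.
  by rewrite -xi mxE mulr0.
by rewrite mulr_le0_ge0 ?ZM 1?eq_sym //; have := x0 j 0; rewrite mxE.
Qed.

Lemma closed_forall_ge0 (T : topologicalType) (I : Type) (h : I -> T -> R) :
  (forall i, continuous (h i)) -> closed [set p | forall i, 0 <= h i p].
Proof.
move=> hc.
have -> : [set p | forall i, 0 <= h i p] =
    \bigcap_i (h i @^-1` [set r | 0 <= r]).
  by apply/seteqP; split=> [p pP i _ | p pP i]; exact: pP.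
apply: closed_bigI => i _.
by apply: preimage_closed => [p _|]; [exact: hc | exact: closed_ge].
Qed.

Lemma segment_mx_mul_continuous P Q i :
  continuous (fun p : R * 'rV[R]_n => (segment_mx P Q p.1 *m p.2^T) i 0).
Proof.
have -> : (fun p : R * 'rV[R]_n => (segment_mx P Q p.1 *m p.2^T) i 0) =
  (fun p => \sum_j ((1 - p.1) * P i j + p.1 * Q i j) * p.2 0 j).
  by apply/funext => p; rewrite mxE; apply: eq_bigr => j _; rewrite !mxE.
move=> p; apply: cvg_big => [|j _]; first exact: add_continuous.
have f1 : (fun q : R * 'rV[R]_n => q.1) @ p --> p.1 by exact: cvg_fst.
apply: cvgM; last first.
  by apply: (@continuous_comp _ _ _ snd (fun v : 'rV[R]_n => v 0 j));
    [exact: cvg_snd | exact: coord_continuous].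
apply: cvgD; apply: cvgM => //; try exact: cvg_cst.
by apply: cvgB => //; exact: cvg_cst.
Qed.

(** At the supremum [t] of the semipositive parameters, compactness yields a simplex vector with
    image [c e]. If [c > 0], the matrix at [t] is semipositive, which contradicts the assumption on
    [Q] when [t = 1] and the supremum when [t < 1]; so [c = 0]. *)
Lemma segment_mx_kernel P Q :
  Z_matrix P -> Z_matrix Q -> semipositive P -> ~ semipositive Q ->
  exists t x, [/\ 0 <= t <= 1, mxle 0 x, x != 0 & segment_mx P Q t *m x = 0].
Proof.
move=> ZP ZQ SP SQ.
(* For [n = 0] every matrix is vacuously semipositive, [Q] included. *)
have [n0|n_gt0] := posnP n.
  by case: SQ; exists 0; move=> -[k kn]; suff: false by []; rewrite n0 in kn.
pose i0 := Ordinal n_gt0.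
pose g i (p : R * 'rV[R]_n) : R := (segment_mx P Q p.1 *m p.2^T) i 0.
have gc i : continuous (g i) by exact: segment_mx_mul_continuous.
pose box : set (R * 'rV[R]_n) :=
  `[0, 1] `*` [set v : 'rV[R]_n | forall i, `[0, 1]%classic (v 0 i)].
(* [K] collects the pairs [(t, v)] with [v] in the standard simplex and
   [segment_mx P Q t *m v^T = c e] for some [c >= 0]. *)
pose K : set (R * 'rV[R]_n) := box `&` ([set p | forall i, 0 <= g i p] `&`
  ([set p | forall ij : 'I_n * 'I_n, 0 <= g ij.1 p - g ij.2 p] `&`
   [set p : R * 'rV[R]_n | \sum_j p.2 0 j = 1])).
have cK : compact K.
  have cbox : compact box.
    apply: compact_setX; first exact: segment_compact.
    by apply: (@rV_compact R n (fun=> `[0, 1]%classic)) => i; exact: segment_compact.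
  apply: compact_closedI => //; apply: closedI; first exact: closed_forall_ge0.
  apply: closedI.
    by apply: closed_forall_ge0 => -[i j] p; apply: cvgB; exact: gc.
  apply: (@preimage_closed _ _ (fun p : R * 'rV[R]_n => \sum_j p.2 0 j)
    [set r | r = 1]); last exact: closed_eq.
  move=> p _; apply: cvg_big => [|j _]; first exact: add_continuous.
  by apply: (@continuous_comp _ _ _ snd (fun v : 'rV[R]_n => v 0 j));
    [exact: cvg_snd | exact: coord_continuous].
(* The projection of a compact set is closed, so it contains [sup S] once it contains [S]. *)
have clT : closed (fst @` K).
  apply: compact_closed; first exact: Rhausdorff.
  apply: continuous_compact => //; apply: continuous_subspaceT => p.
  exact: cvg_fst.
pose S := [set t : R | 0 <= t <= 1 /\ semipositive (segment_mx P Q t)].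
have S0 : S 0.
  split; first by rewrite lexx ler01.
  by rewrite /segment_mx subr0 scale1r scale0r addr0.
have Sub : ubound S 1 by move=> t [/andP[]].
have ST : S `<=` fst @` K.
  move=> t [t01 St].
  have Zt := segment_mx_Z t01 ZP ZQ.
  have [y y0 My] := Z_matrix_solve_ones Zt St.
  have y0' i : 0 <= y i 0 by have := y0 i 0; rewrite mxE.
  pose s := \sum_j y j 0.
  have s0 : 0 < s.
    rewrite lt_neqAle sumr_ge0 // andbT; apply/eqP => /esym /eqP.
    rewrite psumr_eq0 // => /allP y_eq0.
    have := congr1 (fun v : 'cV[R]_n => v i0 0) My.
    have -> : y = 0.
      apply/colP => i; rewrite mxE; apply/eqP.
      exact: (implyP (y_eq0 i (mem_index_enum _))).
    by rewrite mulmx0 !mxE => /eqP; rewrite eq_sym oner_eq0.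
  have gE i : g i (t, s^-1 *: y^T) = s^-1.
    by rewrite /g /= linearZ /= trmxK -scalemxAr My !mxE mulr1.
  exists (t, s^-1 *: y^T) => //; split; first split.
  - by rewrite /= in_itv.
  - move=> i /=; rewrite in_itv /= !mxE mulrC divr_ge0 ?(ltW s0) //=.
    rewrite ler_pdivrMr // mul1r /s (bigD1 i) //= lerDl.
    by apply: sumr_ge0.
  split; first by move=> i; rewrite gE invr_ge0 ltW.
  split; first by move=> ij; rewrite !gE subrr.
  rewrite /= (eq_bigr (fun j => s^-1 * y j 0)) => [|j _]; last by rewrite !mxE.
  by rewrite -mulr_sumr mulVf // gt_eqF.
have /clT[[t v] [[t01 v01] [g0 [geq vsum]]] /= tE] : closure (fst @` K) (sup S).
  by apply: (closureS ST); apply: closure_sup; [exists 0 | exists 1].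
have {}t01 : 0 <= t <= 1 by move: t01; rewrite /= in_itv.
have Zt := segment_mx_Z t01 ZP ZQ.
have v0 : mxle 0 v^T.
  by move=> i j; rewrite (ord1 j) !mxE; have := v01 i; rewrite /= in_itv => /andP[].
(* The pair condition in [K], read in both orders, makes all entries of the image equal. *)
have gE i : g i (t, v) = g i0 (t, v).
  apply/eqP; rewrite eq_le -subr_ge0 (geq (i0, i)) -subr_ge0.
  exact: (geq (i, i0)).
have [gi0|gi0] := eqVneq (g i0 (t, v)) 0.
  exists t, v^T; split=> //; last first.
    by apply/colP => i; rewrite [RHS]mxE -gi0 -(gE i).
  apply/eqP => /(congr1 trmx); rewrite trmxK trmx0 => v_eq0.
  move: vsum; rewrite /= v_eq0 big1 => [|j _]; last by rewrite mxE.
  by move/eqP; rewrite eq_sym oner_eq0.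
have St : semipositive (segment_mx P Q t).
  apply: (@nonneg_semipositive _ v^T) => // i j.
  by rewrite (ord1 j) mxE -/(g i (t, v)) gE lt_neqAle eq_sym gi0 g0.
case/andP: (t01) => t0; rewrite le_eqVlt => /orP[/eqP t1|t1].
  case: SQ; move: St; rewrite t1 /segment_mx subrr scale0r add0r.
  by rewrite scale1r.
have [u /andP[tu u1] Su] := segment_mx_open t1 St.
suff : u <= t by rewrite leNgt tu.
rewrite tE; apply: ub_le_sup; first by exists 1.
by split=> //; rewrite u1 (le_trans t0 (ltW tu)).
Qed.

End Segment.

(** * Spectral radius and M-matrices *)

Section Spectral.
Variables (R : realType) (n : nat).
Implicit Types (M N : 'M[R]_n) (x : 'cV[R]_n).

Lemma normc_sum (I : Type) (s : seq I) (F : I -> complex R) :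
  Normc.normc (\sum_(i <- s) F i) <= \sum_(i <- s) Normc.normc (F i).
Proof.
elim/big_rec2: _ => [|i a b _ ab]; first by rewrite Normc.normc0.
by rewrite (le_trans (le_normcD _ _)) // lerD2l.
Qed.

Lemma normc_real (a : R) : Normc.normc (real_complex R a) = `|a|.
Proof. by rewrite /Normc.normc /= expr0n addr0 sqrtr_sqr. Qed.

Lemma normc_ge0 (z : complex R) : 0 <= Normc.normc z.
Proof. by case: z => a b; exact: sqrtr_ge0. Qed.

(** A Collatz-Wielandt bound. The moduli [u] of a left eigenvector satisfy [|z| u <= u N]; pairing
    with [x] gives [|z| (u x) <= r (u x)], where [u x > 0]. *)
Lemma eigenvalue_normc_le N x r z :
  mxle 0 N -> mxlt 0 x -> mxle (N *m x) (r *: x) ->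
  eigenvalue (map_mx (real_complex R) N) z -> Normc.normc z <= r.
Proof.
move=> N0 x0 Nx /eigenvalueP[v vN v_neq0].
have {}N0 i j : 0 <= N i j by have := N0 i j; rewrite mxE.
have {}x0 i : 0 < x i 0 by have := x0 i 0; rewrite mxE.
pose u j := Normc.normc (v 0 j).
have u0 j : 0 <= u j by exact: normc_ge0.
have zu j : Normc.normc z * u j <= \sum_i u i * N i j.
  have zvj : (z *: v) 0 j = z * v 0 j by rewrite mxE.
  rewrite -Normc.normcM -zvj -vN mxE; apply: le_trans (normc_sum _ _) _.
  apply: ler_sum => i _.
  by rewrite Normc.normcM mxE normc_real ger0_norm.
have ux_gt0 : 0 < \sum_j u j * x j 0.
  rewrite lt_neqAle sumr_ge0 ?andbT => [|j _]; last by rewrite mulr_ge0 // ltW.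
  apply: contra v_neq0; rewrite eq_sym psumr_eq0 => [/allP H|j _]; last first.
    by rewrite mulr_ge0 // ltW.
  apply/eqP/rowP => j; rewrite mxE; apply: Normc.eq0_normc; apply/eqP.
  have := implyP (H j (mem_index_enum _)) isT.
  by rewrite mulf_eq0 (gt_eqF (x0 j)) orbF.
rewrite -(ler_pM2r ux_gt0) !mulr_sumr.
apply: (@le_trans _ _ (\sum_j \sum_i u i * N i j * x j 0)).
  apply: ler_sum => j _; rewrite mulrA -mulr_suml.
  by rewrite ler_wpM2r // ltW.
rewrite exchange_big /=; apply: ler_sum => i _.
have := Nx i 0; rewrite !mxE => Nxi.
rewrite (eq_bigr (fun j => u i * (N i j * x j 0))) => [|j _]; last first.
  by rewrite mulrA.
by rewrite -mulr_sumr mulrCA ler_wpM2l.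
Qed.

Lemma spectral_radius_le N x r :
  mxle 0 N -> mxlt 0 x -> 0 <= r -> mxle (N *m x) (r *: x) ->
  spectral_radius N <= r.
Proof.
move=> N0 x0 r0 Nx; rewrite /spectral_radius; set S := [set _ | _].
have Sr : ubound S r.
  by move=> _ [z zN ->]; exact: (eigenvalue_normc_le N0 x0 Nx zN).
(* Without a supremum, as for [n = 0], [sup] is [0], and [0 <= r] concludes. *)
have [hS|hS] := pselect (has_sup S); last by rewrite sup_out.
by apply: ge_sup => //; case: hS.
Qed.

Lemma row_sum_le N i : mxle 0 N -> \sum_j N i j <= \sum_k \sum_j N k j.
Proof.
move=> N0; rewrite [leRHS](bigD1 i) //= lerDl.
apply: sumr_ge0 => k _; apply: sumr_ge0 => j _.
by have := N0 k j; rewrite mxE.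
Qed.

Lemma le_spectral_radius N z : mxle 0 N ->
  eigenvalue (map_mx (real_complex R) N) z ->
  Normc.normc z <= spectral_radius N.
Proof.
move=> N0 zN; apply: ub_le_sup; last by exists z.
(* Tested on the all-ones vector, every modulus is at most the sum of all entries of [N]. *)
exists (\sum_k \sum_j N k j) => _ [w wN ->].
apply: (@eigenvalue_normc_le N (ones R n)) wN => // [i j|i j].
  by rewrite !mxE.
rewrite (ord1 j) !mxE mulr1 (le_trans _ (row_sum_le i N0)) // ler_sum // => k _.
by rewrite mxE mulr1.
Qed.

(** For [s] above the diagonal, [N = s I - M] is nonnegative, and [M x >= e x] reads
    [N x <= (s - e) x], so the spectral radius of [N] is at most [max 0 (s - e) < s]. *)
Lemma semipositive_M_matrix M : Z_matrix M -> semipositive M -> M_matrix M.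
Proof.
move=> ZM [x x0 Mx].
have {}Mx i : 0 < (M *m x) i 0 by have := Mx i 0; rewrite [X in X < _]mxE.
have x0' i : 0 < x i 0 by have := x0 i 0; rewrite mxE.
have [|e e0 eP] := @pos_lower_bound R n (fun i => (M *m x) i 0 / x i 0).
  by move=> i; rewrite divr_gt0.
pose s := 1 + \sum_i `|M i i|.
have s0 : 0 < s by rewrite ltr_pwDl // sumr_ge0.
have Ms i : M i i <= s.
  rewrite (le_trans (ler_norm _)) // /s (bigD1 i) //= addrCA lerDl.
  by rewrite addr_ge0 // sumr_ge0.
have N0 : mxle 0 (s%:M - M).
  move=> i j; rewrite !mxE; have [->|ij] := eqVneq i j.
    by rewrite mulr1n subr_ge0.
  by rewrite mulr0n sub0r oppr_ge0 ZM.
exists (s%:M - M), s; split=> //; last by rewrite subKr.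
apply: (@le_lt_trans _ _ (Num.max 0 (s - e))); last first.
  by rewrite gt_max s0 ltrBlDr ltrDl.
apply: (spectral_radius_le N0 x0); first by rewrite le_max lexx.
move=> i j; rewrite (ord1 j) mulmxBl mul_scalar_mx.
rewrite (@le_trans _ _ ((s - e) * x i 0)) //; last first.
  rewrite [leRHS]mxE; apply: ler_wpM2r; first exact: ltW.
  by rewrite le_max lexx orbT.
by rewrite mxE [X in X + _]mxE [X in _ + X]mxE mulrBl lerB // -ler_pdivlMr.
Qed.

Lemma M_matrix_Z M : M_matrix M -> Z_matrix M.
Proof.
move=> [N [s [N0 _ ->]]] i j ij; rewrite !mxE (negbTE ij) mulr0n sub0r oppr_le0.
by have := N0 i j; rewrite mxE.
Qed.

(** Otherwise the segment from [w I - N] to [s I - N] contains a singular [r I - N] with [r >= s],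
    and [r] is an eigenvalue of [N] beyond its spectral radius. *)
Lemma M_matrix_semipositive M : M_matrix M -> semipositive M.
Proof.
move=> MM; have ZM := M_matrix_Z MM; case: MM => N [s [N0 Ns ME]].
(* [w] dominates [s], which gives [r >= s], and exceeds every row sum of [N], which makes [w I - N]
   semipositive on the all-ones vector. *)
apply: contrapT => SM; pose w := 1 + `|s| + \sum_k \sum_j N k j.
have ws : s <= w.
  rewrite /w addrAC ler_wpDl ?ler_norm //.
  by rewrite addr_ge0 // sumr_ge0 // => k _; rewrite sumr_ge0 // => j _;
    have := N0 k j; rewrite mxE.
have ZP : Z_matrix (w%:M - N).
  move=> i j ij; rewrite !mxE (negbTE ij) mulr0n sub0r oppr_le0.
  by have := N0 i j; rewrite mxE.
have SP : semipositive (w%:M - N).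
  exists (ones R n) => i j; first by rewrite !mxE.
  rewrite mulmxBl mul_scalar_mx (ord1 j) !mxE mulr1 subr_gt0.
  rewrite (@le_lt_trans _ _ (\sum_k \sum_j N k j)) //.
    rewrite (le_trans _ (row_sum_le i N0)) // ler_sum // => k _.
    by rewrite mxE mulr1.
  by rewrite ltrDr ltr_pwDl.
have [t [x [/andP[t0 t1] x0 x_neq0 Kx]]] := segment_mx_kernel ZP ZM SP SM.
pose r := (1 - t) * w + t * s.
have sr : s <= r by rewrite /r; nra.
have Kr : segment_mx (w%:M - N) M t = r%:M - N.
  rewrite ME; apply/matrixP => i j; rewrite !mxE.
  by case: (i == j); rewrite ?mulr1n ?mulr0n /r; ring.
(* The column kernel vector [x] rules out invertibility, hence a left eigenvector exists as well. *)
have rN : eigenvalue (map_mx (real_complex R) N) (real_complex R r).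
  rewrite eigenvalue_map; apply: contraNT x_neq0; rewrite negbK kermx_eq0.
  rewrite row_free_unit => Nu; rewrite -(mulKmx Nu x) -opprB -Kr mulNmx Kx.
  by rewrite oppr0 mulmx0.
have := le_spectral_radius N0 rN; apply/negP; rewrite -ltNge normc_real.
by rewrite (lt_le_trans Ns) // (le_trans sr) // ler_norm.
Qed.

End Spectral.

(** * Interval matrices, R-matrices and H-matrices *)

Section Interval.
Variables (R : realType) (n : nat).
Implicit Types (A Al Au : 'M[R]_n) (x : 'cV[R]_n).

Lemma segment_interval_matrix Al Au A B t : 0 <= t <= 1 ->
  interval_matrix Al Au A -> interval_matrix Al Au B ->
  interval_matrix Al Au (segment_mx A B t).
Proof.
move=> /andP[t0 t1] [lA Au1] [lB Bu]; split=> i j; rewrite !mxE.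
  by have := lA i j; have := lB i j; nra.
by have := Au1 i j; have := Bu i j; nra.
Qed.

Lemma midpoint_interval_matrix Al Au : mxle Al Au ->
  interval_matrix Al Au (midpoint_matrix Al Au).
Proof.
by move=> lu; split=> i j; rewrite !mxE; have := lu i j; lra.
Qed.

Lemma comparison_Z A : Z_matrix (comparison_matrix A).
Proof. by move=> i j ij; rewrite mxE (negbTE ij) oppr_le0. Qed.

Lemma H_matrix_diag A i : H_matrix A -> A i i != 0.
Proof.
move=> HA.
have := semipositive_diag i (comparison_Z A) (M_matrix_semipositive HA).
by rewrite mxE eqxx normr_gt0.
Qed.

(** A nonzero such [x], restricted to its support [I], solves the R-matrix system with [t = 0]: the
    dropped columns contribute nothing, so the rows inside and outside [I] all give zero. *)
Lemma R_matrix_kernel A x : R_matrix A -> mxle 0 x -> A *m x = 0 -> x = 0.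
Proof.
move=> RA x0 Ax; apply/eqP; apply: contrapT => /negP x_neq0.
pose I := [set i | x i 0 != 0]%SET.
have I0 : I != finset.set0.
  apply: contra x_neq0 => /eqP I0; apply/eqP/colP => i; rewrite mxE.
  have : i \notin I by rewrite I0 inE.
  by rewrite inE negbK => /eqP.
have AI (J : {set 'I_n}) :
    submatrix A J I *m (\col_k x (enum_val k) 0) = 0.
  apply/colP => k; have := congr1 (fun v : 'cV_n => v (enum_val k) 0) Ax.
  rewrite !mxE (bigID (mem I)) /= [X in _ + X]big1 ?addr0 => [|j]; last first.
    by rewrite inE negbK => /eqP ->; rewrite mulr0.
  rewrite big_enum_val => Axk; rewrite -[RHS]Axk.
  by apply: eq_bigr => j _; rewrite !mxE.
apply: (RA I I0); exists (\col_k x (enum_val k) 0), 0; split=> //.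
- by rewrite AI scale0r addr0.
- by move=> i j; rewrite AI scale0r addr0 lexx.
move=> i j; rewrite !mxE lt_neqAle; have := enum_valP i; rewrite inE eq_sym => ->.
by have := x0 (enum_val i) 0; rewrite mxE.
Qed.

Lemma strongly_R_semipositive Al Au :
  mxle Al Au -> M_matrix (midpoint_matrix Al Au) ->
  strongly (@R_matrix R n) (interval_matrix Al Au) -> semipositive Al.
Proof.
move=> lu MAc SR; apply: contrapT => SAl.
have ZAc := M_matrix_Z MAc.
have Ac_in := midpoint_interval_matrix lu.
have ZAl : Z_matrix Al.
  by move=> i j ij; rewrite (le_trans _ (ZAc i j ij)) //; case: Ac_in.
have [t [x [t01 x0 x_neq0 Kx]]] :=
  segment_mx_kernel ZAc ZAl (M_matrix_semipositive MAc) SAl.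
have At : interval_matrix Al Au (segment_mx (midpoint_matrix Al Au) Al t).
  by apply: segment_interval_matrix => //; split.
by move/eqP: x_neq0; apply; exact: R_matrix_kernel (SR _ At) x0 Kx.
Qed.

(** Off the diagonal, a nonpositive midpoint means [Au <= - Al], so [Al <= A <= Au] gives
    [|A i j| <= - Al i j]. *)
Lemma le_comparison_matrix Al Au A :
  Z_matrix (midpoint_matrix Al Au) -> interval_matrix Al Au A ->
  mxle Al (comparison_matrix A).
Proof.
move=> ZAc [lA uA] i j; rewrite mxE; have [<-|ij] := eqVneq i j.
  exact: le_trans (lA i i) (ler_norm _).
have := ZAc i j ij; have := lA i j; have := uA i j; rewrite !mxE lerNr.
by rewrite ler_norml => ? ? ?; apply/andP; split; lra.
Qed.

Lemma strongly_H_diag Al Au A i :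
  mxle Al Au -> M_matrix (midpoint_matrix Al Au) ->
  strongly (@H_matrix R n) (interval_matrix Al Au) ->
  interval_matrix Al Au A -> 0 < A i i.
Proof.
move=> lu MAc SH A_in; rewrite ltNge; apply/negP => Aii.
have := semipositive_diag i (M_matrix_Z MAc) (M_matrix_semipositive MAc).
set c := midpoint_matrix Al Au i i => c0.
have d0 : 0 < c - A i i by rewrite subr_gt0 (le_lt_trans Aii).
(* [t] solves [(1 - t) A i i + t c = 0]: that point of the segment has a zero diagonal entry and is
   no H-matrix. *)
pose t := - A i i / (c - A i i).
have t01 : 0 <= t <= 1.
  rewrite divr_ge0 ?oppr_ge0 ?(ltW d0) //= ler_pdivrMr // mul1r lerDr.
  exact: ltW.
have := SH _ (segment_interval_matrix t01 A_in (midpoint_interval_matrix lu)).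
move/(H_matrix_diag i)/eqP; apply.
rewrite mxE [X in X + _]mxE [X in _ + X]mxE -/c /t.
by field; rewrite gt_eqF.
Qed.

Lemma H_matrix_R_matrix A :
  (forall i, 0 < A i i) -> H_matrix A -> R_matrix A.
Proof.
move=> A0 HA I /set0Pn[i0 i0I] [x [t [AIx _ x0 t0]]].
(* The sum has one term for [i] in [I] and none otherwise: [z] extends [x] by zero. *)
pose z : 'cV[R]_n := \col_i \sum_(k | enum_val k == i) x k 0.
have zI k : z (enum_val k) 0 = x k 0.
  rewrite mxE (big_pred1 k) // => l; exact: (inj_eq enum_val_inj).
have zJ i : i \notin I -> z i 0 = 0.
  move=> iI; rewrite mxE big1 // => k /eqP ki.
  by move: iI; rewrite -ki enum_valP.
have z0 i : 0 <= z i 0.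
  by rewrite mxE sumr_ge0 // => k _; have := x0 k 0; rewrite mxE => /ltW.
have AzI i : i \in I -> (A *m z) i 0 = - t.
  move=> iI; have := congr1 (fun v : 'cV_#|I| => v (enum_rank_in iI i) 0) AIx.
  rewrite !mxE mulr1 => /eqP; rewrite addr_eq0 => /eqP <-.
  rewrite (bigID (mem I)) /= [X in _ + X]big1 ?addr0 => [|j jI]; last first.
    by rewrite zJ // mulr0.
  rewrite big_enum_val; apply: eq_bigr => k _.
  by rewrite zI mxE enum_rankK_in.
(* In the rows of [I], the comparison matrix is at most [A] and [A z = - t]; in the others the
   diagonal term vanishes with [z]. *)
have Cz : mxle (comparison_matrix A *m z) 0.
  move=> i j; rewrite (ord1 j) [leRHS]mxE; have [iI|iI] := boolP (i \in I).
    rewrite (@le_trans _ _ (- t)) ?oppr_le0 // -(AzI i iI) !mxE.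
    apply: ler_sum => k _; rewrite ler_wpM2r // mxE.
    have [<-|ik] := eqVneq i k; first by rewrite gtr0_norm.
    by rewrite lerNl -normrN ler_norm.
  rewrite mxE sumr_le0 // => k _; have [<-|ik] := eqVneq i k.
    by rewrite zJ // mulr0.
  by rewrite mulr_le0_ge0 // comparison_Z.
have := Z_matrix_monotone (comparison_Z A) (M_matrix_semipositive HA) (y := - z).
have Nz : mxle 0 (comparison_matrix A *m - z).
  by move=> i j; have := Cz i j; rewrite mulmxN !mxE oppr_ge0.
move/(_ Nz i0 0); rewrite [leLHS]mxE [leRHS]mxE.
rewrite -(enum_rankK_in i0I i0I) zI oppr_ge0 leNgt.
by have := x0 (enum_rank_in i0I i0) 0; rewrite mxE => ->.
Qed.

End Interval.

Theorem proposition17 (R : realType) (n : nat) (Al Au : 'M[R]_n)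
    (hAlAu : mxle Al Au) (hAc : M_matrix (midpoint_matrix Al Au)) :
  strongly (@R_matrix R n) (interval_matrix Al Au) <->
  strongly (@H_matrix R n) (interval_matrix Al Au).
Proof.
split=> SP A A_in.
  (* Semipositivity passes from [Al] up to the comparison matrix with the same witness. *)
  apply: semipositive_M_matrix; first exact: comparison_Z.
  apply: semipositive_le (strongly_R_semipositive hAlAu hAc SP).
  exact: le_comparison_matrix (M_matrix_Z hAc) A_in.
apply: H_matrix_R_matrix (SP A A_in) => i.
exact: strongly_H_diag hAlAu hAc SP A_in.
Qed.
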